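(* Let $V$ be an $\mathrm{FI}_G$-module over a commutative ring $k$ which is generated in degree $\le d$ and has first homological degree $hd_1(V)\le r$ (with $d,r$ non-negative integers). Then $$\mathrm{reg}(V)\le r+\min\{r,d\}-1,$$ i.e. $hd_i(V)\le i+r+\min\{r,d\}-1$ for all $i\ge 1$.
   Context: Fix a commutative ring $k$ and a group $G$. $\mathrm{FI}_G$ is the category with objects $[n]=\{1,\dots,n\}$ ($n\ge 0$, $[0]=\emptyset$) and morphisms $[n]\to[m]$ the pairs $(f,g)$ with $f:[n]\to[m]$ injective and $g:[n]\to G$ a map of sets; composition is $(f,g)\circ(f',g')=(f\circ f',h)$ with $h(x)=g'(x)\,g(f'(x))$. Write $G_n=\mathfrak S_n\wr G=\mathrm{Aut}_{\mathrm{FI}_G}([n])$. An $\mathrm{FI}_G$-module is a functor $V:\mathrm{FI}_G\to\mathrm{Mod}_k$, $V_n:=V([n])$; these form an abelian category with kernels and cokernels computed pointwise. An $\mathrm{FB}_G$-module is a sequence $(W_n)_{n\ge0}$ with $W_n$ a $k[G_n]$-module (regarded as an $\mathrm{FI}_G$-module in which all maps $[n]\to[m]$, $n<m$, act by zero). For a $k[G_n]$-module $W$, $M(W)$ is the $\mathrm{FI}_G$-module with $M(W)_m=W\otimes_{k[G_n]}k[\mathrm{Hom}_{\mathrm{FI}_G}([n],[m])]$, morphisms acting by postcomposition on the second factor; $M(n):=M(k[G_n])$. $\deg V=\sup\{n:V_n\ne0\}$ (with $\sup\emptyset=-\infty$). $H_0(V)$ is the $\mathrm{FB}_G$-module $H_0(V)_n=V_n/V_{<n}$,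 where $V_{<n}$ is the $k$-span of the images of all $V(f,g)$ for morphisms $(f,g):[m]\to[n]$ with $m<n$; $H_0$ is right exact and $H_i$ denotes its $i$-th left derived functor; $hd_i(V):=\deg H_i(V)$. $V$ is generated in degree $\le m$ if there is a surjection $\bigoplus_{i\in I}M(n_i)\to V$ with all $n_i\le m$ (equivalently $hd_0(V)\le m$). The regularity $\mathrm{reg}(V)$ is the smallest $N$ such that $hd_i(V)-i\le N$ for all $i\ge 1$. *)

(* Defs.v *)
From HB Require Import structures.
From mathcomp Require Import all_boot all_order all_algebra.
Unset Implicit Arguments.
Unset Strict Implicit.
Unset Printing Implicit Defensive.
Import GRing.Theory.
Local Open Scope ring_scope.

Record group := Group {
  gcar :> Type;
  gmul : gcar -> gcar -> gcar;
  gone : gcar;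
  ginv : gcar -> gcar;
  gmulA : forall x y z, gmul x (gmul y z) = gmul (gmul x y) z;
  gmul1 : forall x, gmul gone x = x;
  gmulV : forall x, gmul (ginv x) x = gone
}.

Section FIG.
Variable k : comPzRingType.
Variable G : group.

(* A morphism [n] -> [m] of FI_G is a pair (f, g) with f injective;
   the [act] field below is only constrained on injective f. *)
Definition compG n m p (f : {ffun 'I_m -> 'I_p}) (g : {ffun 'I_m -> G})
  (f' : {ffun 'I_n -> 'I_m}) (g' : {ffun 'I_n -> G})
  : {ffun 'I_n -> 'I_p} * {ffun 'I_n -> G} :=
  ([ffun x => f (f' x)], [ffun x => gmul G (g' x) (g (f' x))]).

Record FIGmod := FIGMod {
  obj : nat -> lmodType k;
  act : forall n m, {ffun 'I_n -> 'I_m} -> {ffun 'I_n -> G} -> obj n -> obj m;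
  act_lin : forall n m (f : {ffun 'I_n -> 'I_m}) (g : {ffun 'I_n -> G}), injectiveb f -> linear (@act n m f g);
  act_id : forall n x, act n n [ffun i => i] [ffun => gone G] x = x;
  act_comp : forall n m p (f : {ffun 'I_m -> 'I_p}) (g : {ffun 'I_m -> G})
    (f' : {ffun 'I_n -> 'I_m}) (g' : {ffun 'I_n -> G}) (x : obj n),
    injectiveb f -> injectiveb f' ->
    act n p (compG n m p f g f' g').1 (compG n m p f g f' g').2 x
      = act m p f g (act n m f' g' x)
}.

Record FIGhom (V W : FIGmod) := FIGHom {
  homf :> forall n, obj V n -> obj W n;
  hom_lin : forall j : nat, linear (homf j);
  hom_nat : forall n m (f : {ffun 'I_n -> 'I_m}) (g : {ffun 'I_n -> G}) (x : obj V n),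
    injectiveb f ->
    homf m (act V n m f g x) = act W n m f g (homf n x)
}.

(* V_{<n}: the k-span of the images of all V(f,g) : V_m -> V_n with m < n. *)
Inductive lower (V : FIGmod) (n : nat) : obj V n -> Prop :=
| lower0 : lower V n 0
| lowerS : forall m (f : {ffun 'I_m -> 'I_n}) g (z : obj V m) (y : obj V n),
    (m < n)%N -> injectiveb f -> lower V n y -> lower V n (act V m n f g z + y).

Definition projective (P : FIGmod) : Prop :=
  forall (A B : FIGmod) (p : FIGhom A B) (q : FIGhom P B),
    (forall n, forall y : obj B n, exists x, p n x = y) ->
    exists l : FIGhom P A, forall n x, p n (l n x) = q n x.

Record proj_res (V : FIGmod) := ProjRes {
  P : nat -> FIGmod;
  dif : forall i, FIGhom (P i.+1) (P i);
  eps : FIGhom (P 0) V;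
  P_proj : forall i, projective (P i);
  eps_surj : forall n, forall y : obj V n, exists x, eps n x = y;
  exact0 : forall n (x : obj (P 0) n), eps n x = 0 <-> exists y, dif 0 n y = x;
  exactS : forall i n (x : obj (P i.+1) n),
    dif i n x = 0 <-> exists y, dif i.+1 n y = x
}.

(* Vanishing of the degree-n part of the i-th homology of the complex
   H_0(P_.) (computed from the resolution R), i.e. H_i(V)_n = 0.
   H_0(P)_n = P_n / P_{<n}, and H_0(dif) is induced by dif. *)
Definition Hvan (V : FIGmod) (R : proj_res V) (i n : nat) : Prop :=
  forall x : obj (P V R i) n,
    (match i return obj (P V R i) n -> Prop with
     | 0 => fun _ => True
     | j.+1 => fun x => lower (P V R j) n (dif V R j n x)
     end x) ->
    exists y : obj (P V R i.+1) n, lower (P V R i) n (x - dif V R i n y).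

(* hd_i(V) <= N, i.e. H_i(V)_n = 0 for all n > N.  H_i is the i-th left derived
   functor of H_0, computed via (any) projective resolution. *)
Definition hd_le (V : FIGmod) (i N : nat) : Prop :=
  forall (R : proj_res V) (n : nat), (N < n)%N -> Hvan V R i n.

(* V is generated in degree <= d, i.e. H_0(V)_n = V_n / V_{<n} = 0 for n > d. *)
Definition gen_in_deg (V : FIGmod) (d : nat) : Prop :=
  forall n, (d < n)%N -> forall x : obj V n, lower V n x.

End FIG.

Arguments gen_in_deg {k G} V d.
Arguments hd_le {k G} V i N.
Arguments Hvan {k G} V R i n.
Arguments lower {k G} V n _.
Arguments projective {k G} P.

(* Main.v *)
(** The homology of an FI_G-module V in degree n is computed by a Koszul complex
    whose p-chains are the sum of the V(T) over subsets T of [n] of size n - p.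
    It only sees the FI-module underlying V and is exact in V.  Splitting the
    subsets according to whether they contain the last element exhibits the
    complex of V in degree n+1 as the cone of the complex of V mapping to that of
    the shift SV in degree n.  With K and D the kernel and cokernel of V -> SV,
    this gives Gan's long exact sequence

      H_(i+1)(DV)_n -> H_(i-1)(KV)_n -> H_i(V)_(n+1) -> H_i(DV)_n -> H_(i-2)(KV)_n.

    Passing from V to DV lowers the degrees of generators and of relations by
    one, so induction bounds H_i(DV); the case i = 2 bounds the degree of KV,
    hence H_(i-1)(KV), and the sequence then bounds H_i(V).  Projectives have no
    higher Koszul homology, being summands of modules with transfer maps, for
    which V -> SV splits; dimension shifting along a projective resolution
    identifies Koszul homology with the derived functors of H_0. *)

From HB Require Import structures.
Require Import Defs.
From mathcomp Require Import all_boot all_order all_algebra.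
From mathcomp Require Import perm boolp zify.

Set Implicit Arguments.
Unset Strict Implicit.
Unset Printing Implicit Defensive.
Import GRing.Theory.
Local Open Scope ring_scope.

(** * The Koszul complex *)

(* The scalars and the G-labels play no role in the complex, so only abelian
   groups with an action of injections are kept. *)
Record FImod := FIMod {
  ob :> nat -> zmodType;
  mor : forall n m, ('I_n -> 'I_m) -> ob n -> ob m;
  morB : forall n m (f : 'I_n -> 'I_m) x y, injective f ->
    mor f (x - y) = mor f x - mor f y;
  mor_id : forall n (x : ob n), mor id x = x;
  mor_comp : forall n m p (f : 'I_m -> 'I_p) (g : 'I_n -> 'I_m) (x : ob n),
    injective f -> injective g -> mor (f \o g) x = mor f (mor g x)
}.

Arguments mor V {n m} f x : rename.

Lemma mor_ext (V : FImod) n m (f g : 'I_n -> 'I_m) (x : V n) :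
  f =1 g -> mor V f x = mor V g x.
Proof. by move=> /funext ->. Qed.

(** * Adjoining a last point, and the shift functor *)

Definition up n m (f : 'I_n -> 'I_m) (i : 'I_n.+1) : 'I_m.+1 :=
  if unlift ord_max i is Some j then lift ord_max (f j) else ord_max.

Lemma up_lift n m (f : 'I_n -> 'I_m) j :
  up f (lift ord_max j) = lift ord_max (f j).
Proof. by rewrite /up liftK. Qed.

Lemma up_max n m (f : 'I_n -> 'I_m) : up f ord_max = ord_max.
Proof. by rewrite /up unlift_none. Qed.

Lemma up_inj n m (f : 'I_n -> 'I_m) : injective f -> injective (up f).
Proof.
move=> f_inj i j; case: (unliftP ord_max i) => [i' ->|->];
  case: (unliftP ord_max j) => [j' ->|->]; rewrite ?up_lift ?up_max //.
- by move=> /lift_inj/f_inj ->.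
- by move=> /eqP; rewrite eq_sym (negbTE (neq_lift _ _)).
- by move=> /eqP; rewrite (negbTE (neq_lift _ _)).
Qed.

Lemma up_comp n m p (f : 'I_m -> 'I_p) (g : 'I_n -> 'I_m) :
  up (f \o g) = up f \o up g.
Proof.
apply/funext => i /=; case: (unliftP ord_max i) => [i' ->|->];
  by rewrite ?(up_lift, up_max).
Qed.

Lemma up_id n : up (@id 'I_n) = id.
Proof.
by apply/funext => i; case: (unliftP ord_max i) => [i' ->|->];
  rewrite ?(up_lift, up_max).
Qed.

Lemma shift_morB (V : FImod) n m (f : 'I_n -> 'I_m) (x y : V n.+1) :
  injective f -> mor V (up f) (x - y) = mor V (up f) x - mor V (up f) y.
Proof. by move=> /up_inj; exact: morB. Qed.

Lemma shift_mor_id (V : FImod) n (x : V n.+1) : mor V (up (@id 'I_n)) x = x.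
Proof. by rewrite up_id mor_id. Qed.

Lemma shift_mor_comp (V : FImod) n m p (f : 'I_m -> 'I_p) (g : 'I_n -> 'I_m)
    (x : V n.+1) : injective f -> injective g ->
  mor V (up (f \o g)) x = mor V (up f) (mor V (up g) x).
Proof. by move=> /up_inj fi /up_inj gi; rewrite up_comp mor_comp. Qed.

Definition shift (V : FImod) : FImod :=
  @FIMod (fun n => V n.+1) (fun n m f => mor V (up f))
    (@shift_morB V) (@shift_mor_id V) (@shift_mor_comp V).

Definition fam (V W : FImod) := forall m, V m -> W m.

Definition additive_fam V W (f : fam V W) :=
  forall m (x y : V m), f m (x - y) = f m x - f m y.

Definition natural_fam V W (f : fam V W) :=
  forall m p (g : 'I_m -> 'I_p) (x : V m), injective g ->
    f p (mor V g x) = mor W g (f m x).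

Definition shift_fam V W (f : fam V W) : fam (shift V) (shift W) :=
  fun m => f m.+1.

(* The map V -> SV induced by the inclusion of [m] in [m+1]. *)
Definition io (V : FImod) : fam V (shift V) := fun m => mor V (lift ord_max).

Lemma io_add V : additive_fam (@io V).
Proof. by by move=> m x y; exact: (@morB V m m.+1 _ _ _ lift_inj). Qed.

Lemma io_nat V : natural_fam (@io V).
Proof.
move=> m p g x g_inj; rewrite /io /= -!mor_comp //;
  try exact: lift_inj; try exact: up_inj.
by apply: mor_ext => i /=; rewrite up_lift.
Qed.

Lemma shift_fam_nat V W (f : fam V W) :
  natural_fam f -> natural_fam (shift_fam f).
Proof. by move=> fn m p g x /up_inj; exact: fn. Qed.

Lemma io_fam V W (f : fam V W) m (x : V m) : natural_fam f ->
  shift_fam f (io x) = io (f m x).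
Proof. by move=> fn; apply: fn; exact: lift_inj. Qed.

Definition prodZ (A B : zmodType) : zmodType := (A * B)%type.

(* [chain n p V] is the sum of the V(T) over the T of [n] with n - p elements:
   either T contains the last element, and counts for SV in degree n - 1, or it
   does not.  The nonexistent chains with n < p are trivial ('I_1). *)
Fixpoint chain_pos (n p : nat) (V : FImod) : zmodType :=
  match n with
  | 0 => 'I_1
  | n'.+1 => prodZ (chain_pos n' p (shift V))
      (match p with 0 => V n' | p'.+1 => chain_pos n' p' V end)
  end.

(** Degree 0 is split off so that [chain n 0 V] is convertible to [V n] for a variable [n]. *)
Definition chain (n p : nat) (V : FImod) : zmodType :=
  if p is p'.+1 then chain_pos n p' V else V n.

Fixpoint chmap_pos (n p : nat) (V W : FImod) (f : fam V W) :
    chain_pos n p V -> chain_pos n p W :=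
  match n return chain_pos n p V -> chain_pos n p W with
  | 0 => fun=> 0
  | n'.+1 => fun x => (@chmap_pos n' p _ _ (shift_fam f) x.1,
      (match p return chain n' p V -> chain n' p W with
       | 0 => f n' | p'.+1 => @chmap_pos n' p' V W f end) x.2)
  end.

Definition chmap (n p : nat) (V W : FImod) (f : fam V W) : chain n p V -> chain n p W :=
  match p return chain n p V -> chain n p W with
  | 0 => f n | p'.+1 => @chmap_pos n p' V W f end.

(** The differential of the mapping cone of [io]. *)
Fixpoint bd (n p : nat) (V : FImod) {struct n} : chain n p.+1 V -> chain n p V :=
  match n return chain n p.+1 V -> chain n p V with
  | 0 => fun=> 0
  | n'.+1 =>
    match p return chain n'.+1 p.+1 V -> chain n'.+1 p V with
    | 0 => fun x => @bd n' 0 (shift V) x.1 + io x.2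
    | p'.+1 => fun x => (@bd n' p'.+1 (shift V) x.1 + @chmap n' p'.+1 V _ (@io V) x.2,
                         - @bd n' p' V x.2)
    end
  end.

Definition subfam (V : FImod) := forall m, V m -> Prop.

(* [chain_in Q x]: all the coordinates of the chain x lie in Q. *)
Fixpoint chain_in_pos (n p : nat) (V : FImod) (Q : subfam V) : chain_pos n p V -> Prop :=
  match n return chain_pos n p V -> Prop with
  | 0 => fun=> True
  | n'.+1 => fun x => @chain_in_pos n' p (shift V) (fun m => Q m.+1) x.1 /\
      (match p return chain n' p V -> Prop with
       | 0 => Q n' | p'.+1 => @chain_in_pos n' p' V Q end) x.2
  end.

Definition chain_in (n p : nat) (V : FImod) (Q : subfam V) : chain n p V -> Prop :=
  match p return chain n p V -> Prop with
  | 0 => Q n | p'.+1 => @chain_in_pos n p' V Q end.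

Arguments chain : simpl never.
Arguments chmap : simpl never.
Arguments chain_in : simpl never.
Arguments bd : simpl never.

Lemma chmapS n p V W (f : fam V W) (x : chain n.+1 p.+1 V) :
  chmap f x = (chmap (p := p.+1) (shift_fam f) x.1, chmap (p := p) f x.2).
Proof. by []. Qed.

Lemma chain_inS n p V (Q : subfam V) (x : chain n.+1 p.+1 V) :
  chain_in Q x = (chain_in (V := shift V) (p := p.+1) (fun m => Q m.+1) x.1 /\
                  chain_in (p := p) Q x.2).
Proof. by []. Qed.

Lemma bdS0 n V (x : chain n.+1 1 V) : bd x = @bd n 0 (shift V) x.1 + io x.2.
Proof. by []. Qed.

Lemma bdSS n p V (x : chain n.+1 p.+2 V) :
  bd x = (@bd n p.+1 (shift V) x.1 + chmap (p := p.+1) (@io V) x.2, - @bd n p V x.2).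
Proof. by []. Qed.

Lemma chain_eq n p V (x y : chain n.+1 p.+1 V) : x.1 = y.1 -> x.2 = y.2 -> x = y.
Proof. by case: x y => [a b] [c d] /= -> ->. Qed.

Lemma chmapB n p V W (f : fam V W) (x y : chain n p V) : additive_fam f ->
  chmap f (x - y) = chmap f x - chmap f y.
Proof.
move=> fB; elim: n p V W f fB x y => [|n IH] [|p] V W f fB x y //;
  try exact: fB.
- by rewrite [LHS]ord1 [RHS]ord1.
rewrite !chmapS; apply: chain_eq; last exact: (IH p _ _ f fB x.2 y.2).
by apply: (IH p.+1 _ _ (shift_fam f) _ x.1 y.1) => m; exact: fB.
Qed.

Lemma additive0 (A B : zmodType) (f : A -> B) :
  (forall x y, f (x - y) = f x - f y) -> f 0 = 0.
Proof. by move=> fB; rewrite -[0 in LHS](subrr 0) fB subrr. Qed.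

Lemma additiveN (A B : zmodType) (f : A -> B) :
  (forall x y, f (x - y) = f x - f y) -> forall x, f (- x) = - f x.
Proof. by move=> fB x; rewrite -[- x]sub0r fB (additive0 fB) sub0r. Qed.

Lemma additiveD (A B : zmodType) (f : A -> B) :
  (forall x y, f (x - y) = f x - f y) -> forall x y, f (x + y) = f x + f y.
Proof. by move=> fB x y; rewrite -[y in LHS]opprK fB (additiveN fB) opprK. Qed.

Lemma chmapN n p V W (f : fam V W) (x : chain n p V) : additive_fam f ->
  chmap f (- x) = - chmap f x.
Proof. by move=> fB; apply: additiveN => ? ?; exact: chmapB. Qed.

Lemma chmapD n p V W (f : fam V W) (x y : chain n p V) : additive_fam f ->
  chmap f (x + y) = chmap f x + chmap f y.
Proof. by move=> fB; apply: additiveD => ? ?; exact: chmapB. Qed.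

Lemma bdB n p V (x y : chain n p.+1 V) : bd (x - y) = bd x - bd y.
Proof.
elim: n p V x y => [|n IH] [|p] V x y; rewrite ?subr0 //.
- by rewrite !bdS0 /= IH io_add opprD addrACA.
- rewrite !bdSS; apply: chain_eq; rewrite /= !IH.
    by rewrite (chmapB _ _ (@io_add V)) opprD addrACA.
  by rewrite opprD.
Qed.

Lemma bd_0 n p V : bd (0 : chain n p.+1 V) = 0.
Proof. exact: additive0 (@bdB n p V). Qed.

Lemma bdN n p V (x : chain n p.+1 V) : bd (- x) = - bd x.
Proof. exact: additiveN (@bdB n p V) _. Qed.

Lemma bdD n p V (x y : chain n p.+1 V) : bd (x + y) = bd x + bd y.
Proof. exact: additiveD (@bdB n p V) _ _. Qed.

Lemma chmap_comp n p V W U (f : fam V W) (g : fam W U) (x : chain n p V) :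
  chmap g (chmap f x) = chmap (fun m => g m \o f m) x.
Proof.
elim: n p V W U f g x => [|n IH] [|p] V W U f g x //.
rewrite !chmapS; apply: chain_eq; last exact: (IH p _ _ _ f g x.2).
exact: (IH p.+1 _ _ _ (shift_fam f) (shift_fam g) x.1).
Qed.

Lemma chmap_ext n p V W (f g : fam V W) (x : chain n p V) :
  (forall m (y : V m), f m y = g m y) -> chmap f x = chmap g x.
Proof.
elim: n p V W f g x => [|n IH] [|p] V W f g x fg //; try exact: fg.
rewrite !chmapS; apply: chain_eq; last exact: (IH p _ _ f g x.2).
by apply: (IH p.+1 _ _ (shift_fam f) (shift_fam g) x.1) => m; exact: fg.
Qed.

Lemma bd_chmap n p V W (f : fam V W) (x : chain n p.+1 V) :
  additive_fam f -> natural_fam f -> bd (chmap f x) = chmap f (bd x).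
Proof.
elim: n p V W f x => [|n IH] p V W f x fB fN.
  case: p x => [|p] x; last by rewrite [LHS]ord1 [RHS]ord1.
  exact/esym/(additive0 (fB 0%N)).
have sB : additive_fam (shift_fam f) by move=> m; exact: fB.
have sN := shift_fam_nat fN.
case: p x => [|p] x.
  rewrite !bdS0; apply: (eq_trans _ (esym (additiveD (fB n.+1) _ _))).
  congr (_ + _); last exact: esym (io_fam x.2 fN).
  exact: (IH 0%N _ _ (shift_fam f) x.1 sB sN).
rewrite !bdSS !chmapS; apply: chain_eq.
- apply: (eq_trans _ (esym (chmapD (p := p.+1) _ _ sB))).
  congr (_ + _); first exact: (IH p.+1 _ _ (shift_fam f) x.1 sB sN).
  rewrite !chmap_comp; apply: chmap_ext => m y /=.
  by rewrite -io_fam.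
- apply: (eq_trans _ (esym (chmapN (p := p) _ fB))).
  by congr (- _); exact: (IH p _ _ f x.2 fB fN).
Qed.

(** [bd] commutes with the map induced by [io], so the sign in the cone makes the two mixed terms
    cancel. *)
Lemma bd_bd n p V (x : chain n p.+2 V) : bd (bd x) = 0.
Proof.
elim: n p V x => [|n IH] p V x; first by case: p x.
case: p x => [|p] x.
  rewrite bdSS bdS0 /= (@bdD n 0 (shift V)).
  rewrite /= IH add0r.
  rewrite (@bd_chmap n 0 _ _ (@io V) x.2 (@io_add V) (@io_nat V)).
  by apply: (eq_trans (congr1 _ (additiveN (@io_add V n) _))); rewrite subrr.
rewrite !bdSS; apply: chain_eq => /=.
  rewrite (@bdD n p.+1) IH add0r bd_chmap; [|exact: io_add|exact: io_nat].
  by rewrite (@chmapN n p.+1 _ _ (@io V) _ (@io_add V)) subrr.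
by rewrite (@bdN n p) IH !oppr0.
Qed.

(** * Chains with coordinates in a subfamily *)

Definition subgroup_fam V (Q : subfam V) :=
  (forall m, Q m 0) /\ (forall m (x y : V m), Q m x -> Q m y -> Q m (x - y)).

Definition stable_fam V (Q : subfam V) :=
  forall m p (f : 'I_m -> 'I_p) x, injective f -> Q m x -> Q p (mor V f x).

Definition shift_sub V (Q : subfam V) : subfam (shift V) := fun m => Q m.+1.

Lemma shift_subgroup V (Q : subfam V) :
  subgroup_fam Q -> subgroup_fam (shift_sub Q).
Proof. by case=> Q0 QB; split=> m; [exact: Q0|exact: QB]. Qed.

Lemma shift_stable V (Q : subfam V) : stable_fam Q -> stable_fam (shift_sub Q).
Proof. by move=> Qs m p f x /up_inj; exact: Qs. Qed.

Lemma chain_in0 n p V (Q : subfam V) : subgroup_fam Q -> chain_in Q (0 : chain n p V).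
Proof.
elim: n p V Q => [|n IH] [|p] V Q QG //; try by case: QG => + _; exact.
by rewrite chain_inS; split; [exact: (IH p.+1) (shift_subgroup QG)|exact: (IH p)].
Qed.

Lemma chain_inB n p V (Q : subfam V) (x y : chain n p V) : subgroup_fam Q ->
  chain_in Q x -> chain_in Q y -> chain_in Q (x - y).
Proof.
elim: n p V Q x y => [|n IH] [|p] V Q x y QG //; try by case: QG => _; exact.
rewrite !chain_inS => -[x1 x2] [y1 y2].
by split; [exact: (IH p.+1) (shift_subgroup QG) _ _|exact: (IH p)].
Qed.

Lemma chain_inN n p V (Q : subfam V) (x : chain n p V) : subgroup_fam Q ->
  chain_in Q x -> chain_in Q (- x).
Proof. by move=> QG Qx; rewrite -sub0r; apply: chain_inB => //; exact: chain_in0. Qed.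

Lemma chain_inD n p V (Q : subfam V) (x y : chain n p V) : subgroup_fam Q ->
  chain_in Q x -> chain_in Q y -> chain_in Q (x + y).
Proof.
by move=> QG Qx Qy; rewrite -[y]opprK; apply: chain_inB => //; exact: chain_inN.
Qed.

Lemma chain_in_map n p V W (f : fam V W) (Q : subfam V) (Q' : subfam W)
    (x : chain n p V) :
  (forall m (y : V m), Q m y -> Q' m (f m y)) -> chain_in Q x -> chain_in Q' (chmap f x).
Proof.
elim: n p V W f Q Q' x => [|n IH] [|p] V W f Q Q' x fQ //; try exact: fQ.
rewrite !chain_inS => -[x1 x2]; rewrite chmapS; split=> /=.
  by apply: (IH p.+1) x1 => m; exact: fQ.
exact: (IH p) x2.
Qed.

Lemma chain_in_preim n p V W (f : fam V W) (Q : subfam W) (x : chain n p V) :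
  chain_in Q (chmap f x) -> chain_in (fun m y => Q m (f m y)) x.
Proof.
elim: n p V W f Q x => [|n IH] [|p] V W f Q x //.
rewrite !chain_inS chmapS => -[x1 x2]; split=> /=.
  exact: (IH p.+1 _ _ (shift_fam f)) x1.
exact: (IH p) x2.
Qed.

Lemma chain_in_sub n p V (Q Q' : subfam V) (x : chain n p V) :
  (forall m (y : V m), Q m y -> Q' m y) -> chain_in Q x -> chain_in Q' x.
Proof.
elim: n p V Q Q' x => [|n IH] [|p] V Q Q' x QQ' //; try exact: QQ'.
rewrite !chain_inS => -[x1 x2]; split; last exact: (IH p) x2.
by apply: (IH p.+1) x1 => m; exact: QQ'.
Qed.

Lemma chain_in_all n p V (x : chain n p V) : chain_in (fun _ _ => True) x.
Proof.
elim: n p V x => [|n IH] [|p] V x //; rewrite chain_inS; split.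
  exact: (IH p.+1).
exact: (IH p).
Qed.

Lemma chain_in_bd n p V (Q : subfam V) (x : chain n p.+1 V) :
  subgroup_fam Q -> stable_fam Q -> chain_in Q x -> chain_in Q (bd x).
Proof.
elim: n p V Q x => [|n IH] p V Q x QG Qs; first by move=> _; exact: chain_in0.
have sG := shift_subgroup QG; have ss := shift_stable Qs.
have ioQ m (y : V m) : Q m y -> shift_sub Q (io y).
  by apply: Qs; exact: lift_inj.
case: p x => [|p] x; rewrite chain_inS => -[x1 x2].
  rewrite bdS0; apply: (chain_inD (p := 0) sG); first exact: IH.
  exact: ioQ.
rewrite bdSS chain_inS; split=> /=; last by apply: (chain_inN QG); exact: IH.
apply: (chain_inD sG); first exact: IH.
exact: chain_in_map x2.
Qed.

(** Exactness of chains in the coefficients: each coordinate is lifted separately. *)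
Lemma chain_in_lift n p V W (f : fam V W) (Q : subfam V) (R Q' : subfam W)
    (y : chain n p W) :
  (forall m (z : W m), Q' m z -> exists2 x, Q m x & R m (z - f m x)) ->
  chain_in Q' y -> exists2 x, chain_in Q x & chain_in R (y - chmap f x).
Proof.
elim: n p V W f Q R Q' y => [|n IH] [|p] V W f Q R Q' y lif; try exact: lif.
  by exists 0.
rewrite chain_inS => -[y1 y2].
have [x1 Qx1 Rx1] := IH p.+1 _ _ (shift_fam f) (shift_sub Q) (shift_sub R) _ _
  (fun m => lif m.+1) y1.
have [x2 Qx2 Rx2] := IH p _ _ _ _ _ _ _ lif y2.
by exists (x1, x2).
Qed.

Definition zero_sub V : subfam V := fun m x => x = 0.

Lemma chain_in_zero n p V (x : chain n p V) : chain_in (@zero_sub V) x <-> x = 0.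
Proof.
split; last first.
  move=> ->; apply: chain_in0; split=> [//|m a b -> ->]; exact: subr0.
elim: n p V x => [|n IH] [|p] V x //; first by rewrite ord1.
rewrite chain_inS => -[x1 x2]; apply: chain_eq => /=; first exact: (IH p.+1).
exact: (IH p).
Qed.

Definition full_sub V : subfam V := fun _ _ => True.

(** * Koszul homology of subquotients *)

Definition cyc n p V (Z : subfam V) : chain n p V -> Prop :=
  match p return chain n p V -> Prop with
  | 0 => fun=> True | _.+1 => fun x => chain_in Z (bd x) end.

(* Submodules and quotients are not constructed: [Hzero B Z p n] says that the
   p-th Koszul homology of B / (B :&: Z), for B and Z inside V, is zero in
   degree n. *)
Definition Hzero V (B Z : subfam V) p n :=
  forall x : chain n p V, chain_in B x -> cyc Z x ->
    exists2 y : chain n p.+1 V, chain_in B y & chain_in Z (x - bd y).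

(* DV is shift V modulo [Dsub Z] and KV is [Ksub Z] modulo Z when V stands for
   the quotient of V by Z. *)
Definition Dsub V (Z : subfam V) : subfam (shift V) :=
  fun m x => exists2 y : V m, True & Z m.+1 (x - io y).

Definition Ksub V (Z : subfam V) : subfam V := fun m x => Z m.+1 (io x).

Lemma subrACA (A : zmodType) (x y a b : A) : (x - y) - (a - b) = (x - a) - (y - b).
Proof. by rewrite !opprD !opprK addrACA. Qed.

Lemma subgroupD V (Q : subfam V) m (x y : V m) :
  subgroup_fam Q -> Q m x -> Q m y -> Q m (x + y).
Proof. exact: (@chain_inD m 0 V). Qed.

Lemma Dsub_subgroup V (Z : subfam V) : subgroup_fam Z -> subgroup_fam (Dsub Z).
Proof.
move=> [Z0 ZB]; split=> [m|m x y [a _ xa] [b _ yb]].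
  by exists 0; rewrite // (additive0 (@io_add V m)) subrr; exact: Z0.
by exists (a - b) => //; rewrite io_add subrACA; exact: ZB.
Qed.

Lemma Dsub_stable V (Z : subfam V) : stable_fam Z -> stable_fam (Dsub Z).
Proof.
move=> Zs m p f x f_inj [a _ xa]; exists (mor V f a) => //.
rewrite io_nat // /= -morB; last exact: up_inj.
by apply: Zs => //; exact: up_inj.
Qed.

Lemma Ksub_subgroup V (Z : subfam V) : subgroup_fam Z -> subgroup_fam (Ksub Z).
Proof.
move=> [Z0 ZB]; split=> [m|m x y]; rewrite /Ksub.
  by rewrite (additive0 (@io_add V m)); exact: Z0.
by rewrite io_add; exact: ZB.
Qed.

(** With [Dsub_chain_in], exactness of chains for V -> SV -> DV: a chain of SV dies in DV exactly
    when it agrees modulo [Z] with the image of a chain of V. *)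
Lemma chain_in_Dsub n p V (Z : subfam V) (a : chain n p (shift V)) (c : chain n p V) :
  subgroup_fam Z -> chain_in (shift_sub Z) (a - chmap (@io V) c) -> chain_in (Dsub Z) a.
Proof.
move=> ZG Zac; have DG := Dsub_subgroup ZG.
rewrite -[a](subrK (chmap (@io V) c)); apply: chain_inD => //.
  apply: chain_in_sub Zac => m z Zz; exists 0 => //.
  by rewrite (additive0 (@io_add V m)) subr0.
apply: chain_in_map (chain_in_all c) => m z _; exists z => //.
by rewrite subrr; exact: (ZG.1 m.+1).
Qed.

Lemma Dsub_chain_in n p V (Z : subfam V) (a : chain n p (shift V)) :
  chain_in (Dsub Z) a -> exists c : chain n p V, chain_in (shift_sub Z) (a - chmap (@io V) c).
Proof.
move=> Da; suff [c _ Zc] : exists2 c : chain n p V, chain_in (@full_sub V) c &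
    chain_in (shift_sub Z) (a - chmap (@io V) c) by exists c.
by apply: chain_in_lift Da => m z [c _ Zc]; exists c.
Qed.

(** * Consequences of Gan's long exact sequence *)

(** For i = 0, and for i = 1 in [HzeroD1], the term H_(i-2)(KV) is zero, so H_i(V)_(n+1) maps onto
    H_i(DV)_n. *)
Lemma HzeroD0 V (Z : subfam V) n : subgroup_fam Z ->
  Hzero (@full_sub V) Z 0 n.+1 -> Hzero (@full_sub (shift V)) (Dsub Z) 0 n.
Proof.
move=> ZG V0 x _ _; have [y _ Zy] := V0 x I I.
exists y.1; first exact: chain_in_all.
exists y.2 => //; move: Zy; rewrite /chain_in bdS0 opprD addrA; exact.
Qed.

Lemma HzeroD1 V (Z : subfam V) n : subgroup_fam Z ->
  Hzero (@full_sub V) Z 1 n.+1 -> Hzero (@full_sub (shift V)) (Dsub Z) 1 n.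
Proof.
move=> ZG V1 x _ [b _ xb].
have cx : @cyc n.+1 1 V Z (x, - b).
  by rewrite /cyc bdS0 /= (additiveN (@io_add V n)).
have [y _] := V1 (x, - b) (chain_in_all _) cx.
rewrite bdSS chain_inS /= opprD addrA => -[Zy _].
exists y.1; first exact: chain_in_all.
exact: (@chain_in_Dsub n 1 V Z _ y.2 ZG Zy).
Qed.

(** Exactness of H_2(DV)_n -> H_0(KV)_n -> H_1(V)_(n+1) in the middle. *)
Lemma HzeroK0 V (Z : subfam V) n : subgroup_fam Z -> stable_fam Z ->
  Hzero (@full_sub (shift V)) (Dsub Z) 2 n -> Hzero (@full_sub V) Z 1 n.+1 ->
  Hzero (Ksub Z) Z 0 n.
Proof.
move=> ZG Zs D2 V1 z Kz _.
have sG := shift_subgroup ZG; have ss := shift_stable Zs.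
have cz : @cyc n.+1 1 V Z (0, z) by rewrite /cyc bdS0 /= bd_0 add0r.
have [y _] := V1 (0, z) (chain_in_all _) cz.
case: (y : chain n 2 (shift V) * chain n 1 V)%type => e c.
rewrite bdSS chain_inS /= sub0r opprK => -[Ze Zc].
have De : chain_in (Dsub Z) (bd e).
  apply: (@chain_in_Dsub _ _ _ _ _ (- c) ZG).
  by rewrite (chmapN _ (@io_add V)) opprK -[X in chain_in _ X]opprK; exact: chain_inN.
have [f _ /Dsub_chain_in [g Zg]] := D2 e (chain_in_all _) De.
(* Adding [bd g] to [c] moves it into [Ksub Z] and leaves its boundary unchanged. *)
have Zb : chain_in (shift_sub Z) (chmap (@io V) (bd g + c)).
  rewrite (chmapD _ _ (@io_add V)) -bd_chmap; [|exact: io_add|exact: io_nat].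
  have := chain_inB sG (chain_inN sG Ze) (chain_in_bd sG ss Zg).
  by rewrite opprK !bdB bd_bd subr0 opprB addrC addrA subrK addrC.
exists (- (bd g + c)); first exact: (chain_inN (Ksub_subgroup ZG) (chain_in_preim Zb)).
by rewrite bdN bdD bd_bd add0r opprK.
Qed.

(** Exactness of H_p(KV)_n -> H_(p+1)(V)_(n+1) -> H_(p+1)(DV)_n in the middle. *)
Lemma HzeroVS V (Z : subfam V) p n : subgroup_fam Z -> stable_fam Z ->
  Hzero (Ksub Z) Z p n -> Hzero (@full_sub (shift V)) (Dsub Z) p.+1 n ->
  Hzero (@full_sub V) Z p.+1 n.+1.
Proof.
move=> ZG Zs Kp Dp x _ cx.
have sG := shift_subgroup ZG; have ss := shift_stable Zs.
have ioB := @io_add V; have ioN := @io_nat V.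
case: (x : chain n p.+1 (shift V) * chain n p V)%type cx => a b cx {x}.
have [Zab cb] : chain_in (shift_sub Z) (bd a + chmap (@io V) b) /\ cyc Z b.
  case: p b a cx {Kp Dp} => [|p] b a; first by rewrite /cyc bdS0.
  rewrite /cyc bdSS chain_inS => -[Zab Zb]; split=> //.
  by rewrite -[bd b]opprK; exact: chain_inN.
have Da : cyc (Dsub Z) a.
  by apply: (@chain_in_Dsub _ _ _ _ _ (- b) ZG); rewrite chmapN // opprK.
have [e _ /Dsub_chain_in [c Zc]] := Dp a (chain_in_all _) Da.
have Kb : chain_in (Ksub Z) (bd c + b).
  apply: (chain_in_preim (Q := shift_sub Z)).
  have := chain_inB sG Zab (chain_in_bd sG ss Zc).
  by rewrite !bdB bd_bd subr0 bd_chmap // chmapD // opprB addrC addrA subrK.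
have cKb : cyc Z (bd c + b).
  case: p b a c e cb {Kp Dp cx Zab Da Zc Kb} => [|p] b a c e //= cb.
  by rewrite bdD bd_bd add0r.
have [k Kk Zk] := Kp _ Kb cKb.
(* [e] bounds [a] in DV up to [io c]; [k] bounds the remainder [bd c + b] in KV, and [io] sends [k]
   into [Z]. *)
exists (e, c - k); first exact: chain_in_all.
have Z1 : chain_in (shift_sub Z) (a - (bd e + chmap (@io V) (c - k))).
  rewrite chmapB // opprD opprB addrA [chmap _ k - _]addrC addrA.
  by apply: (chain_inD sG Zc); apply: chain_in_map Kk => m z.
have Z2 : chain_in Z (b + bd (c - k)) by rewrite bdB addrCA addrA.
case: p b a c e k Z1 Z2 {Kp Dp cx Zab Da Kb cb cKb Zk Kk Zc}
  => [|p] b a c e k Z1 Z2; rewrite chain_inS ?(bdS0, bdSS) /=; split=> //;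
  by rewrite opprK.
Qed.

(** The boundary of a 1-chain is a sum of images under injections [n-1] -> [n]; this is the matching
    induction principle. *)
Lemma bd_mem n V (B : subfam V) (L : V n -> Prop) (y : chain n 1 V) :
  L 0 -> (forall x z, L x -> L z -> L (x + z)) ->
  (forall m (f : 'I_m -> 'I_n) x, m.+1 = n -> injective f -> B m x ->
    L (mor V f x)) ->
  chain_in B y -> L (bd y).
Proof.
elim: n V B L y => [|n IH] V B L y L0 LD LB //.
rewrite chain_inS bdS0 => -[B1 B2]; have LD' := LD; apply: LD'.
  apply: (IH (shift V) (shift_sub B) L) B1 => [//|x z|m f x mn f_inj Bx].
    exact: LD.
  by apply: LB Bx; [rewrite mn | exact: up_inj].
by apply: LB B2 => //; exact: lift_inj.
Qed.

(** The last point is sent to the value that f misses. Thus what [io] kills modulo a stable family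
    is killed by every injection [m] -> [m+1]. *)
Lemma inj_lift_max m (f : 'I_m -> 'I_m.+1) : injective f ->
  exists2 s : 'I_m.+1 -> 'I_m.+1, injective s & f =1 s \o lift ord_max.
Proof.
move=> f_inj; have [c Nc] : exists c, c \notin codom f.
  apply/existsP; rewrite -negb_forall; apply/negP => /forallP fS.
  have := card_codom f_inj; rewrite (eq_card (B := 'I_m.+1)) ?card_ord; first lia.
  by move=> c; rewrite fS.
exists (fun i => if unlift ord_max i is Some j then f j else c); last first.
  by move=> i /=; rewrite liftK.
move=> i j; case: (unliftP ord_max i) => [i' ->|->];
  case: (unliftP ord_max j) => [j' ->|->] //.
- by move=> /f_inj ->.
- by move=> fc; rewrite -fc codom_f in Nc.
- by move=> fc; rewrite fc codom_f in Nc.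
Qed.

(* All non-invertible maps act as zero on KV, so KV is its own H_0. *)
Lemma Ksub_vanish V (Z : subfam V) n : subgroup_fam Z -> stable_fam Z ->
  Hzero (Ksub Z) Z 0 n -> forall x, Ksub Z x -> Z n x.
Proof.
move=> ZG Zs K0 x Kx; have [y Ky Zy] := K0 x Kx I.
rewrite -[x](subrK (bd y)); apply: (subgroupD ZG Zy).
apply: bd_mem Ky => [||m f z mn f_inj Kz].
- exact: ZG.1.
- by move=> *; exact: subgroupD.
- subst n; have [s s_inj fs] := inj_lift_max f_inj.
  rewrite (mor_ext _ fs) mor_comp //; last exact: lift_inj.
  exact: Zs.
Qed.

(** The coordinates of a p-chain in degree n lie in V_(n-p). *)
Lemma chain_in_high n p V N (Q Q' : subfam V) (x : chain n p V) : (N + p <= n)%N ->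
  (forall m y, (N <= m)%N -> Q m y -> Q' m y) -> chain_in Q x -> chain_in Q' x.
Proof.
elim: n p V N Q Q' x => [|n IH] [|p] V N Q Q' x Nn QQ' //;
  try by apply: QQ'; rewrite addn0 in Nn.
rewrite !chain_inS => -[Q1 Q2]; split; last by apply: (IH p _ N) Q2 => //; lia.
case: N QQ' Nn => [|N] QQ' Nn.
  by apply: (chain_in_sub (p := p.+1)) Q1 => m y; exact: QQ'.
apply: (IH p.+1 _ N) Q1; first by lia.
by move=> m y Nm; exact: QQ'.
Qed.

Lemma Hzero_high V (B Z : subfam V) N p n : subgroup_fam B -> (N + p <= n)%N ->
  (forall m y, (N <= m)%N -> B m y -> Z m y) -> Hzero B Z p n.
Proof.
move=> BG Nn BZ x Bx _; exists 0; first exact: chain_in0.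
by rewrite bd_0 subr0; exact: (chain_in_high Nn BZ Bx).
Qed.

Lemma Hzero_sub V (B Z : subfam V) p n : subgroup_fam B ->
  (forall m y, B m y -> Z m y) -> Hzero B Z p n.
Proof.
move=> BG BZ x Bx _; exists 0; first exact: chain_in0.
by rewrite bd_0 subr0; exact: (chain_in_sub BZ Bx).
Qed.

Lemma Hzero_pos0 V (Z : subfam V) p : Hzero (@full_sub V) Z p.+1 0.
Proof. by move=> x _ _; exists 0. Qed.

(** Nakayama's lemma: modulo [Z], V_n is spanned by images from degree n - 1. *)
Lemma gen_empty V (Z : subfam V) : subgroup_fam Z -> stable_fam Z ->
  (forall n, Hzero (@full_sub V) Z 0 n) -> forall n x, Z n x.
Proof.
move=> ZG Zs V0; elim=> [|n IH] x; have [y _ Zy] := V0 _ x I I;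
  rewrite -[x](subrK (bd y)); apply: (subgroupD ZG Zy); first exact: ZG.1.
apply: bd_mem (chain_in_all y) => [||m f z [mn] f_inj _].
- exact: ZG.1.
- by move=> *; exact: subgroupD.
- by subst m; exact/Zs/IH.
Qed.

(** By induction H_2(DV) = 0, so H_0(KV) = 0 and KV = 0; then H_(p+1)(V)_(n+1) embeds in
    H_(p+1)(DV)_n = 0. *)
Lemma Hzero_acyclic e V (Z : subfam V) : subgroup_fam Z -> stable_fam Z ->
  (forall n, (e <= n)%N -> Hzero (@full_sub V) Z 0 n) ->
  (forall n, Hzero (@full_sub V) Z 1 n) ->
  forall p n, Hzero (@full_sub V) Z p.+1 n.
Proof.
elim: e V Z => [|e IH] V Z ZG Zs V0 V1 p n.
  have Vz := gen_empty ZG Zs (fun n => V0 n (leq0n n)).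
  by apply: Hzero_sub.
case: n => [|n]; first exact: Hzero_pos0.
have DG := Dsub_subgroup ZG; have Ds := Dsub_stable Zs.
have Dp : forall p n, Hzero (@full_sub (shift V)) (Dsub Z) p.+1 n.
  apply: IH => // m; last exact: HzeroD1.
  by move=> em; apply: HzeroD0 => //; exact: V0.
apply: HzeroVS => //; apply: Hzero_sub => [|m]; first exact: Ksub_subgroup.
by apply: Ksub_vanish => //; exact: HzeroK0.
Qed.

(** Induction on the strict generation bound e, starting from the zero module; for r > 0 the bounds
    for DV are e - 1 and r - 1. *)
Theorem Hzero_regularity e r V (Z : subfam V) : subgroup_fam Z -> stable_fam Z ->
  (forall n, (e <= n)%N -> Hzero (@full_sub V) Z 0 n) ->
  (forall n, (r < n)%N -> Hzero (@full_sub V) Z 1 n) ->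
  forall p n, (p.+1 + r + minn r.+1 e <= n.+1)%N ->
    Hzero (@full_sub V) Z p.+1 n.
Proof.
elim: e r V Z => [|e IH] r V Z ZG Zs V0 V1 p n pn.
  have Vz := gen_empty ZG Zs (fun n => V0 n (leq0n n)).
  by apply: Hzero_sub.
case: n pn => [|n] pn; first exact: Hzero_pos0.
case: r V1 pn => [|r] V1 pn.
  (* H_1(V)_0 is always zero, so r = 0 means that H_1(V) vanishes altogether. *)
  apply: (@Hzero_acyclic e.+1) => // -[|m]; [exact: Hzero_pos0 | exact: V1].
have DG := Dsub_subgroup ZG; have Ds := Dsub_stable Zs.
have Dp : forall p n, (p.+1 + r + minn r.+1 e <= n.+1)%N ->
    Hzero (@full_sub (shift V)) (Dsub Z) p.+1 n.
  apply: IH => // m mm; last by apply: HzeroD1 => //; exact: V1.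
  by apply: HzeroD0 => //; exact: V0.
apply: HzeroVS => //; last by apply: Dp; lia.
(* The constant is the least m at which [Dp] gives H_2(DV)_m = 0; KV vanishes from there on. *)
apply: (@Hzero_high _ _ _ (r.+1 + minn r.+1 e)); [exact: Ksub_subgroup|lia|].
move=> m y my; apply: Ksub_vanish => //.
by apply: HzeroK0 => //; [apply: Dp; lia | apply: V1; lia].
Qed.

(** * Koszul homology of projectives *)

(* The base-change law for pullback squares makes V -> SV naturally split, as for
   the FI#-modules of Church, Ellenberg and Farb. *)
Record transfer (V : FImod) := Transfer {
  tr : forall n m, ('I_n -> 'I_m) -> V m -> V n;
  trB : forall n m (f : 'I_n -> 'I_m) x y, tr f (x - y) = tr f x - tr f y;
  tr_id : forall n (x : V n), tr id x = x;
  tr_pullback : forall m n p q (f : 'I_m -> 'I_p) (g : 'I_n -> 'I_p)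
      (f' : 'I_q -> 'I_n) (g' : 'I_q -> 'I_m) (x : V m),
    injective f -> injective f' -> f \o g' =1 g \o f' ->
    (forall i j, f i = g j -> exists2 l, g' l = i & f' l = j) ->
    tr g (mor V f x) = mor V f' (tr g' x)
}.

Lemma shift_trB V (t : transfer V) n m (f : 'I_n -> 'I_m) (x y : V m.+1) :
  tr t (up f) (x - y) = tr t (up f) x - tr t (up f) y.
Proof. exact: trB. Qed.

Lemma shift_tr_id V (t : transfer V) n (x : V n.+1) : tr t (up (@id 'I_n)) x = x.
Proof. by rewrite up_id tr_id. Qed.

Lemma shift_tr_pullback V (t : transfer V) m n p q
    (f : 'I_m -> 'I_p) (g : 'I_n -> 'I_p)
    (f' : 'I_q -> 'I_n) (g' : 'I_q -> 'I_m) (x : V m.+1) :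
  injective f -> injective f' -> f \o g' =1 g \o f' ->
  (forall i j, f i = g j -> exists2 l, g' l = i & f' l = j) ->
  tr t (up g) (mor V (up f) x) = mor V (up f') (tr t (up g') x).
Proof.
move=> fi f'i /funext fg pb; apply: tr_pullback; try exact: up_inj.
  by move=> i; rewrite -!up_comp fg.
move=> i j; case: (unliftP ord_max i) => [i' ->|->];
  case: (unliftP ord_max j) => [j' ->|->]; rewrite ?up_lift ?up_max.
- by move=> /lift_inj/pb[l <- <-]; exists (lift ord_max l); rewrite up_lift.
- by move=> /eqP; rewrite eq_sym (negbTE (neq_lift _ _)).
- by move=> /eqP; rewrite (negbTE (neq_lift _ _)).
- by exists ord_max; rewrite up_max.
Qed.

Definition shift_transfer V (t : transfer V) : transfer (shift V) :=
  @Transfer (shift V) (fun n m f => tr t (up f))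
    (@shift_trB V t) (@shift_tr_id V t) (@shift_tr_pullback V t).

(** The transfer along [m] -> [m+1] retracts V -> SV, so KV = 0, and DV inherits transfers;
    induction on n concludes. *)
Lemma transfer_acyclic n V (t : transfer V) (Z : subfam V) p :
  subgroup_fam Z -> stable_fam Z ->
  (forall m q (f : 'I_m -> 'I_q) x, Z q x -> Z m (tr t f x)) ->
  Hzero (@full_sub V) Z p.+1 n.
Proof.
elim: n V t Z p => [|n IH] V t Z p ZG Zs Zt; first exact: Hzero_pos0.
apply: HzeroVS => //.
  apply: Hzero_sub => [|m y /(Zt _ _ (lift ord_max))]; first exact: Ksub_subgroup.
  rewrite /io (@tr_pullback _ t m m m.+1 m _ _ id id) ?mor_id ?tr_id //.
    exact: lift_inj.
  by move=> i j /lift_inj <-; exists i.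
apply: (IH _ (shift_transfer t)); [exact: Dsub_subgroup|exact: Dsub_stable|].
move=> m q f x [a _ Za]; exists (tr t f a) => //.
(* The pullback of the standard inclusion along [up f] is the standard inclusion, with [f] as the
   other side. *)
have <- : tr t (up f) (io a) = io (tr t f a).
  apply: tr_pullback; try exact: lift_inj; first by move=> i /=; rewrite up_lift.
  move=> i j; case: (unliftP ord_max j) => [j' ->|->]; rewrite ?up_lift ?up_max.
    by move=> /lift_inj ->; exists j'.
  by move=> /eqP; rewrite eq_sym (negbTE (neq_lift _ _)).
by rewrite /= -trB; exact: Zt.
Qed.

(** * Products of modules over an arbitrary index type *)

Section DepProd.
Variables (k : comPzRingType) (I : Type) (T : I -> lmodType k).

Definition dprod := forall i, T i.

HB.instance Definition _ := gen_eqMixin dprod.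
HB.instance Definition _ := gen_choiceMixin dprod.

Let zero : dprod := fun=> 0.
Let opp (a : dprod) : dprod := fun i => - a i.
Let add (a b : dprod) : dprod := fun i => a i + b i.
Let scale (c : k) (a : dprod) : dprod := fun i => c *: a i.

Let addA : associative add.
Proof. by move=> a b c; apply: functional_extensionality_dep => i; exact: addrA. Qed.
Let addC : commutative add.
Proof. by move=> a b; apply: functional_extensionality_dep => i; exact: addrC. Qed.
Let add0 : left_id zero add.
Proof. by move=> a; apply: functional_extensionality_dep => i; exact: add0r. Qed.
Let addN : left_inverse zero opp add.
Proof. by move=> a; apply: functional_extensionality_dep => i; exact: addNr. Qed.

HB.instance Definition _ := GRing.isZmodule.Build dprod addA addC add0 addN.

Let scaleA a b v : scale a (scale b v) = scale (a * b) v.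
Proof. by apply: functional_extensionality_dep => i; exact: scalerA. Qed.
Let scale1 : left_id 1 scale.
Proof. by move=> a; apply: functional_extensionality_dep => i; exact: scale1r. Qed.
Let scaleDr : right_distributive scale +%R.
Proof. by move=> a b c; apply: functional_extensionality_dep => i; exact: scalerDr. Qed.
Let scaleDl v : {morph scale^~ v : a b / a + b}.
Proof. by move=> a b; apply: functional_extensionality_dep => i; exact: scalerDl. Qed.

HB.instance Definition _ :=
  GRing.Zmodule_isLmodule.Build k dprod scaleA scale1 scaleDr scaleDl.

Lemma dprod_ext (a b : dprod) : (forall i, a i = b i) -> a = b.
Proof. exact: functional_extensionality_dep. Qed.

Lemma dprod_linE c (a b : dprod) i : (c *: a + b) i = c *: a i + b i.
Proof. by []. Qed.

End DepProd.

Arguments obj {k G} f0 n.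
Arguments act {k G} f0 {n m} f g x.
Arguments act_lin {k G} f0 {n m f} g _ a x y.
Arguments act_id {k G} f0 {n} x.
Arguments act_comp {k G} f0 {n m p} f g f' g' x.
Arguments homf {k G V W} f0 n x.
Arguments FIGhom {k G} V W.
Arguments FIGHom {k G V W}.
Arguments hom_lin {k G V W} f0 j a x y.
Arguments hom_nat {k G V W} f0 {n m} f g x.
Arguments proj_res {k G} V.
Arguments P {k G V} p _.
Arguments dif {k G V} p i.
Arguments eps {k G V} p.

(** * Restriction from FI_G to FI by trivial labels *)

Section Restriction.
Variables (k : comPzRingType) (G : group).

Lemma gmulV_r (x : G) : gmul G x (ginv G x) = gone G.
Proof.
rewrite -[LHS]gmul1 -[in LHS](gmulV G (ginv G x)) -gmulA.
by rewrite [gmul G _ (gmul G x _)]gmulA gmulV gmul1 gmulV.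
Qed.

Lemma gmul1_r (x : G) : gmul G x (gone G) = x.
Proof. by rewrite -(gmulV G x) gmulA gmulV_r gmul1. Qed.

Definition tid n : {ffun 'I_n -> 'I_n} := [ffun i => i].
Definition one_lab n : {ffun 'I_n -> G} := [ffun=> gone G].

Lemma tid_inj n : injectiveb (tid n).
Proof. by apply/injectiveP => i j; rewrite !ffunE. Qed.

Lemma comp_inj n m p (f : {ffun 'I_m -> 'I_p}) (g : {ffun 'I_n -> 'I_m}) :
  injectiveb f -> injectiveb g -> injectiveb [ffun x => f (g x)].
Proof.
move=> /injectiveP fi /injectiveP gi; apply/injectiveP => i j.
by rewrite !ffunE => /fi/gi.
Qed.

Variable V : FIGmod k G.

Lemma act_compE n m p (f : {ffun 'I_m -> 'I_p}) (g : {ffun 'I_m -> G})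
    (f' : {ffun 'I_n -> 'I_m}) (g' : {ffun 'I_n -> G}) (x : obj V n)
    (f'' : {ffun 'I_n -> 'I_p}) (g'' : {ffun 'I_n -> G}) :
  injectiveb f -> injectiveb f' ->
  (forall i, f'' i = f (f' i)) -> (forall i, g'' i = gmul G (g' i) (g (f' i))) ->
  act V f g (act V f' g' x) = act V f'' g'' x.
Proof.
move=> fi f'i fE gE; rewrite -act_comp //; congr (act V _ _ x);
  by apply/ffunP => i; rewrite ffunE.
Qed.

Lemma res_morB n m (f : 'I_n -> 'I_m) (x y : obj V n) : injective f ->
  act V [ffun i => f i] (one_lab n) (x - y) =
  act V [ffun i => f i] (one_lab n) x - act V [ffun i => f i] (one_lab n) y.
Proof.
move=> fi; have f_inj : injectiveb [ffun i => f i].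
  by apply/injectiveP => i j; rewrite !ffunE => /fi.
have := act_lin V (one_lab n) f_inj (-1) y x.
by rewrite !scaleN1r ![- _ + _]addrC.
Qed.

Lemma res_mor_id n (x : obj V n) : act V [ffun i => id i] (one_lab n) x = x.
Proof. exact: act_id. Qed.

Lemma res_mor_comp n m p (f : 'I_m -> 'I_p) (g : 'I_n -> 'I_m) (x : obj V n) :
  injective f -> injective g ->
  act V [ffun i => (f \o g) i] (one_lab n) x =
  act V [ffun i => f i] (one_lab m) (act V [ffun i => g i] (one_lab n) x).
Proof.
move=> fi gi; apply/esym/act_compE => [||i|i].
- by apply/injectiveP => i j; rewrite !ffunE => /fi.
- by apply/injectiveP => i j; rewrite !ffunE => /gi.
- by rewrite !ffunE.
- by rewrite !ffunE gmul1.
Qed.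

Definition res : FImod :=
  @FIMod (obj V) (fun n m f => act V [ffun i => f i] (one_lab n))
    res_morB res_mor_id res_mor_comp.

End Restriction.

(* In degree m the cover is the product over n of the V_n-valued functions on
   all maps [n] -> [m], injective or not; a morphism (f, g) pushes functions
   forward along f and twists the values by the pullback of g.  Pulling functions
   back along maps provides the transfers. *)
Section Cover.
Variables (k : comPzRingType) (G : group) (V : FIGmod k G).

Definition cov_index m := {q : nat & {ffun 'I_q -> 'I_m}}.

Definition cov_obj m : lmodType k :=
  dprod (fun i : cov_index m => obj V (tag i)).

Definition ix m q (h : {ffun 'I_q -> 'I_m}) : cov_index m :=
  Tagged (fun q => {ffun 'I_q -> 'I_m}) h.

Definition fcomp (T : Type) n m (f : {ffun 'I_m -> T}) (h : {ffun 'I_n -> 'I_m}) :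
  {ffun 'I_n -> T} := [ffun x => f (h x)].

Definition cov_act n m (f : {ffun 'I_n -> 'I_m}) (g : {ffun 'I_n -> G})
    (a : cov_obj n) : cov_obj m :=
  fun i => \sum_(h : {ffun 'I_(tag i) -> 'I_n} | fcomp f h == tagged i)
    act V (tid _) (fcomp g h) (a (ix h)).

Lemma fcomp_inj n m q (f : {ffun 'I_n -> 'I_m}) :
  injectiveb f -> injective (@fcomp 'I_m q n f).
Proof.
move=> /injectiveP f_inj h h' /ffunP hh'; apply/ffunP => i.
by have := hh' i; rewrite !ffunE => /f_inj.
Qed.

(** Composition with an injection is injective, so only one term of the sum survives. *)
Lemma cov_act_in n m q (f : {ffun 'I_n -> 'I_m}) (g : {ffun 'I_n -> G}) a
    (h : {ffun 'I_q -> 'I_n}) : injectiveb f ->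
  cov_act f g a (ix (fcomp f h)) = act V (tid _) (fcomp g h) (a (ix h)).
Proof.
move=> f_inj; rewrite /cov_act /= (big_pred1 h) // => h'.
by rewrite /= (inj_eq (fcomp_inj f_inj)).
Qed.

Lemma cov_act_out n m q (f : {ffun 'I_n -> 'I_m}) (g : {ffun 'I_n -> G}) a
    (h : {ffun 'I_q -> 'I_m}) : (forall h', fcomp f h' <> h) ->
  cov_act f g a (ix h) = 0.
Proof. by move=> Nh; rewrite /cov_act big_pred0 // => h'; exact/eqP/Nh. Qed.

Lemma cov_act_cases n m q (f : {ffun 'I_n -> 'I_m}) (h : {ffun 'I_q -> 'I_m}) :
  (exists h', h = fcomp f h') \/ (forall h', fcomp f h' <> h).
Proof.
have [/existsP[h' /eqP <-]|Nh] := boolP [exists h', fcomp f h' == h].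
  by left; exists h'.
by right=> h' e; case/existsP: Nh; exists h'; exact/eqP.
Qed.

Lemma cov_ext m (a b : cov_obj m) :
  (forall q (h : {ffun 'I_q -> 'I_m}), a (ix h) = b (ix h)) -> a = b.
Proof. by move=> ab; apply: dprod_ext => -[q h]; exact: ab. Qed.

Lemma cov_act_lin n m (f : {ffun 'I_n -> 'I_m}) (g : {ffun 'I_n -> G}) :
  injectiveb f -> linear (@cov_act n m f g).
Proof.
move=> f_inj c a b; apply: cov_ext => q h; rewrite dprod_linE.
have [[h' ->]|Nh] := cov_act_cases f h; last first.
  by rewrite !cov_act_out // scaler0 addr0.
by rewrite !cov_act_in // dprod_linE act_lin // tid_inj.
Qed.

Lemma cov_act_id n (a : cov_obj n) : cov_act [ffun i => i] [ffun=> gone G] a = a.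
Proof.
apply: cov_ext => q h.
have i_inj : injectiveb [ffun i : 'I_n => i] by exact: tid_inj.
have hE : fcomp [ffun i => i] h = h by apply/ffunP => i; rewrite !ffunE.
have := cov_act_in [ffun=> gone G] a h i_inj; rewrite hE => ->.
rewrite -[RHS]act_id; congr (act V _ _ _).
by apply/ffunP => i; rewrite !ffunE.
Qed.

Lemma cov_act_comp n m p (f : {ffun 'I_m -> 'I_p}) (g : {ffun 'I_m -> G})
    (f' : {ffun 'I_n -> 'I_m}) (g' : {ffun 'I_n -> G}) (a : cov_obj n) :
  injectiveb f -> injectiveb f' ->
  cov_act (compG G n m p f g f' g').1 (compG G n m p f g f' g').2 a
    = cov_act f g (cov_act f' g' a).
Proof.
move=> fi f'i; apply: cov_ext => q h.
have ci := comp_inj fi f'i.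
have cE (h' : {ffun 'I_q -> 'I_n}) :
    fcomp f (fcomp f' h') = fcomp (compG G n m p f g f' g').1 h'.
  by apply/ffunP => i; rewrite !ffunE.
have [[h' ->]|Nh] := cov_act_cases f h; last first.
  rewrite [RHS]cov_act_out // cov_act_out // => h'.
  by rewrite -cE; exact: Nh.
rewrite [RHS]cov_act_in //.
have [[h'' ->]|Nh] := cov_act_cases f' h'; last first.
  rewrite [cov_act f' _ _ _]cov_act_out //.
  have L := act_lin V (fcomp g h') (tid_inj q) (-1) 0 0.
  rewrite !scaleN1r addNr in L; rewrite L addNr.
  apply: cov_act_out => h''; rewrite -cE => /(fcomp_inj fi); exact: Nh.
rewrite cE !cov_act_in //; apply/esym/act_compE; try exact: tid_inj.
  by move=> i; rewrite !ffunE.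
by move=> i; rewrite !ffunE.
Qed.

Definition cover : FIGmod k G :=
  FIGMod k G cov_obj cov_act cov_act_lin cov_act_id cov_act_comp.

Definition cov_tr n m (f : 'I_n -> 'I_m) (a : cov_obj m) : cov_obj n :=
  fun i => a (ix [ffun x => f (tagged i x)]).

Lemma cov_tr_id n (a : cov_obj n) : cov_tr id a = a.
Proof.
apply: cov_ext => q h; rewrite /cov_tr /=; congr (a (ix _)).
by apply/ffunP => i; rewrite ffunE.
Qed.

(** By the pullback property h factors through f' exactly when g h factors through f; otherwise both
    sides are zero at h. *)
Lemma cov_tr_pullback m n p q (f : 'I_m -> 'I_p) (g : 'I_n -> 'I_p)
    (f' : 'I_q -> 'I_n) (g' : 'I_q -> 'I_m) (a : cov_obj m) :
  injective f -> injective f' -> f \o g' =1 g \o f' ->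
  (forall i j, f i = g j -> exists2 l, g' l = i & f' l = j) ->
  cov_tr g (mor (res cover) f a) = mor (res cover) f' (cov_tr g' a).
Proof.
move=> fi f'i fg pb; apply: cov_ext => s h; rewrite /cov_tr /=.
have fib : injectiveb [ffun i => f i].
  by apply/injectiveP => i j; rewrite !ffunE => /fi.
have f'ib : injectiveb [ffun i => f' i].
  by apply/injectiveP => i j; rewrite !ffunE => /f'i.
have [[h' ->]|Nh] := cov_act_cases [ffun i => f' i] h; last first.
  rewrite [RHS]cov_act_out // cov_act_out // => h' /ffunP e.
  have /fin_all_exists2[l gl fl] i : exists2 l, g' l = h' i & f' l = h i.
    by apply: pb; have := e i; rewrite !ffunE.
  apply: (Nh [ffun i => l i]); apply/ffunP => i; by rewrite !ffunE fl.
rewrite cov_act_in //.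
have -> : [ffun x => g (fcomp [ffun i => f' i] h' x)] =
    fcomp [ffun i => f i] [ffun x => g' (h' x)].
  by apply/ffunP => i; rewrite !ffunE; have /= <- := fg (h' i).
rewrite cov_act_in //; congr (act V _ _ _).
by apply/ffunP => i; rewrite !ffunE.
Qed.

Definition cov_transfer : transfer (res cover) :=
  @Transfer (res cover) cov_tr (fun _ _ _ _ _ => erefl) cov_tr_id cov_tr_pullback.

Lemma cover_acyclic p n : Hzero (@full_sub (res cover)) (@zero_sub _) p.+1 n.
Proof.
apply: (transfer_acyclic _ (t := cov_transfer)).
- by split=> // m x y -> ->; exact: subr0.
- move=> m q f x fi ->.
  exact: (additive0 (fun x y => morB (f := f) x y fi)).
- by move=> m q f x ->; exact: (additive0 (trB cov_transfer f)).
Qed.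

End Cover.

Lemma linear_B (k : pzRingType) (U W : lmodType k) (f : U -> W) :
  linear f -> forall x y, f (x - y) = f x - f y.
Proof.
by move=> fL x y; have := fL (-1) y x; rewrite !scaleN1r ![- _ + _]addrC.
Qed.

(** * The natural surjection from the cover *)

Section Projection.
Variables (k : comPzRingType) (G : group) (V : FIGmod k G).

Definition cov_part m q (a : cov_obj V m) : obj V m :=
  \sum_(h : {ffun 'I_q -> 'I_m} | injectiveb h) act V h (one_lab G q) (a (ix h)).

(** An injection [q] -> [m] has q <= m, so a sum over injections alone is finite although the
    product is not. *)
Definition cov_proj m (a : cov_obj V m) : obj V m :=
  \sum_(q < m.+1) cov_part q a.

Lemma cov_proj_lin m : linear (@cov_proj m).
Proof.
move=> c a b; rewrite /cov_proj scaler_sumr -big_split; apply: eq_bigr => q _.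
rewrite /cov_part scaler_sumr -big_split; apply: eq_bigr => h h_inj.
by rewrite dprod_linE act_lin.
Qed.

Lemma act_sum n m (f : {ffun 'I_n -> 'I_m}) (g : {ffun 'I_n -> G})
    (I : finType) (A : pred I) (F : I -> obj V n) : injectiveb f ->
  act V f g (\sum_(i | A i) F i) = \sum_(i | A i) act V f g (F i).
Proof.
move=> f_inj; have fB := linear_B (act_lin V g f_inj).
exact: (big_morph _ (additiveD fB) (additive0 fB)).
Qed.

(** Injections that do not factor through f carry the value zero; the others are f h for a unique
    injective h, and (f h, 1)(id, g h) = (f, g)(h, 1). *)
Lemma cov_part_nat n m q (f : {ffun 'I_n -> 'I_m}) (g : {ffun 'I_n -> G})
    (a : cov_obj V n) : injectiveb f ->
  cov_part q (cov_act f g a) = act V f g (cov_part q a).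
Proof.
move=> f_inj; rewrite /cov_part act_sum //.
pose S := [set h : {ffun 'I_q -> 'I_n} | injectiveb h].
rewrite (bigID (mem (fcomp f @: S))) /= [X in _ + X]big1 ?addr0; last first.
  move=> h /andP[h_inj Nh]; rewrite cov_act_out.
    exact: (additive0 (linear_B (act_lin V _ h_inj))).
  move=> h' e; case/imsetP: Nh; exists h' => //; rewrite inE.
  apply/injectiveP => i j hij; apply: (injectiveP _ h_inj).
  by rewrite -e !ffunE hij.
rewrite (eq_bigl (mem (fcomp f @: S))); last first.
  move=> h /=; apply: andb_idl => /imsetP[h']; rewrite inE => h'_inj ->.
  exact: comp_inj.
rewrite /= big_imset /=; last by move=> h h' _ _; exact: fcomp_inj.
rewrite (eq_bigl (fun h : {ffun 'I_q -> 'I_n} => injectiveb h)); last first.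
  by move=> h; rewrite inE.
apply: eq_bigr => h h_inj; rewrite cov_act_in //.
transitivity (act V (fcomp f h) (fcomp g h) (a (ix h))).
  apply: act_compE; [exact: comp_inj|exact: tid_inj| |] => i; rewrite !ffunE //.
  by rewrite gmul1_r.
by apply/esym/act_compE => // i; rewrite !ffunE ?gmul1.
Qed.

Lemma cov_proj_nat n m (f : {ffun 'I_n -> 'I_m}) (g : {ffun 'I_n -> G})
    (a : cov_obj V n) : injectiveb f ->
  cov_proj (cov_act f g a) = act V f g (cov_proj a).
Proof.
move=> f_inj; rewrite /cov_proj act_sum //.
have nm : (n <= m)%N by have := leq_card f (injectiveP _ f_inj); rewrite !card_ord.
(* Sizes q with n < q <= m contribute nothing: there is no injection [q] -> [n]. *)
rewrite [RHS](big_ord_widen m.+1 (fun q => act V f g (cov_part q a))) //.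
rewrite [RHS]big_mkcond /=; apply: eq_bigr => q _; rewrite cov_part_nat //.
case: ifPn => // Nq; rewrite /cov_part big_pred0.
  exact: (additive0 (linear_B (act_lin V g f_inj))).
move=> h; apply: contraNF Nq => /injectiveP/leq_card.
by rewrite !card_ord ltnS.
Qed.

Definition cover_hom : FIGhom (cover V) V :=
  @FIGHom k G (cover V) V cov_proj cov_proj_lin (fun n m f g x fi => cov_proj_nat g x fi).

Lemma cov_proj_surj n (y : obj V n) : exists x, cov_proj x = y.
Proof.
pose i0 := ix (tid n).
(* The family supported at the identity of [n], with value [y] there. *)
exists (fun i => if pselect (i0 = i) is left e
  then eq_rect i0 (fun i : cov_index n => obj V (tag i)) y i e else 0).
rewrite /cov_proj big_ord_recr /= big1 ?add0r => [|q _].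
  rewrite /cov_part (bigD1 (tid n)) ?tid_inj //= big1 ?addr0.
    case: pselect => // e.
    by rewrite (Prop_irrelevance e erefl) /=; exact: act_id.
  move=> h /andP[h_inj Nh]; case: pselect => [e|_].
    by move: Nh; rewrite (eq_from_Tagged e) eqxx.
  exact: (additive0 (linear_B (act_lin V _ h_inj))).
rewrite /cov_part big1 // => h h_inj; case: pselect => [e|_].
  have /= nq := congr1 (@tag _ _) e.
  have lt_qn := ltn_ord q.
  by rewrite ltnNge (eq_leq nq) in lt_qn.
exact: (additive0 (linear_B (act_lin V _ h_inj))).
Qed.

End Projection.

Section Homs.
Variables (k : comPzRingType) (G : group) (V W : FIGmod k G) (f : FIGhom V W).

Definition res_hom : fam (res V) (res W) := fun m x => homf f m x.

Lemma res_hom_add : additive_fam res_hom.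
Proof. by move=> m; exact: linear_B (hom_lin f m). Qed.

Lemma res_hom_nat : natural_fam res_hom.
Proof.
move=> m p g x gi; apply: hom_nat.
by apply/injectiveP => i j; rewrite !ffunE => /gi.
Qed.

End Homs.

Lemma id_hom_lin (k : comPzRingType) (G : group) (V : FIGmod k G) (j : nat) :
  linear (@id (obj V j)).
Proof. by []. Qed.

Definition id_hom (k : comPzRingType) (G : group) (V : FIGmod k G) : FIGhom V V :=
  FIGHom (fun n x => x) (@id_hom_lin k G V) (fun _ _ _ _ _ _ => erefl).

Lemma chmap_id n p V (x : chain n p V) : chmap (fun m (y : V m) => y) x = x.
Proof.
elim: n p V x => [|n IH] [|p] V x //; first by rewrite [LHS]ord1 [RHS]ord1.
rewrite chmapS; apply: chain_eq => /=; [exact: (IH p.+1)|exact: (IH p)].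
Qed.

(** Lifting the identity through the cover makes V a retract of an acyclic module. *)
Lemma projective_acyclic (k : comPzRingType) (G : group) (V : FIGmod k G) p n :
  projective V -> Hzero (@full_sub (res V)) (@zero_sub _) p.+1 n.
Proof.
move=> Vp; have [l lP] := Vp _ _ (cover_hom V) (id_hom V) (@cov_proj_surj _ _ V).
have lB := res_hom_add l; have lN := res_hom_nat l.
have cB := res_hom_add (cover_hom V); have cN := res_hom_nat (cover_hom V).
move=> x _ /chain_in_zero cx.
have clx : cyc (@zero_sub _) (chmap (res_hom l) x).
  by apply/chain_in_zero; rewrite bd_chmap // cx (additive0 (fun a b => chmapB a b lB)).
have [y _ /chain_in_zero/subr0_eq e] := @cover_acyclic k G V p n _ (chain_in_all _) clx.
exists (chmap (res_hom (cover_hom V)) y); first exact: chain_in_all.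
apply/chain_in_zero/eqP; rewrite subr_eq0 bd_chmap // -e chmap_comp; apply/eqP.
rewrite -[LHS]chmap_id; apply: chmap_ext => m z; exact/esym/lP.
Qed.

(** * Dimension shifting *)

Section DimensionShift.
Variables (V : FImod) (B : subfam V).
Hypotheses (BG : subgroup_fam B) (Bs : stable_fam B).
Variable n : nat.
Hypothesis Vac : forall p, Hzero (@full_sub V) (@zero_sub V) p.+1 n.

Lemma acyclicP p (x : chain n p.+1 V) : bd x = 0 -> exists y, x = bd y.
Proof.
move=> /chain_in_zero x0; have [y _ /chain_in_zero/subr0_eq ->] := Vac (chain_in_all x) x0.
by exists y.
Qed.

(** With [Hzero_quot_inv]: as V is acyclic, H_(p+1)(V/B) is the kernel of H_p(B) -> H_p(V), and the
    condition says that this kernel is zero. *)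
Lemma Hzero_quot p :
  (forall w : chain n p.+1 V, chain_in B (bd w) -> exists2 y, chain_in B y & bd w = bd y) ->
  Hzero (@full_sub V) B p.+1 n.
Proof.
move=> H x _ /H[y By xy]; have /acyclicP[w xyw] : bd (x - y) = 0.
  by rewrite bdB xy subrr.
by exists w; [exact: chain_in_all | rewrite -xyw opprB addrC subrK].
Qed.

Lemma Hzero_quot_inv p (w : chain n p.+1 V) : Hzero (@full_sub V) B p.+1 n ->
  chain_in B (bd w) -> exists2 y, chain_in B y & bd w = bd y.
Proof.
move=> H /(H w (chain_in_all w))[u _ Bu]; exists (w - bd u) => //.
by rewrite bdB bd_bd subr0.
Qed.

Lemma Hzero_shift p : Hzero (@full_sub V) B p.+2 n -> Hzero B (@zero_sub V) p.+1 n.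
Proof.
move=> H x Bx /chain_in_zero/acyclicP[w xw]; rewrite xw in Bx.
have [y By wy] := Hzero_quot_inv H Bx.
by exists y => //; apply/chain_in_zero; rewrite xw wy subrr.
Qed.

End DimensionShift.

(** * Images, kernels and the first isomorphism theorem *)

Definition im_fam V W (f : fam V W) : subfam W := fun m y => exists x, f m x = y.
Definition ker_fam V W (f : fam V W) : subfam V := fun m x => f m x = 0.

Section Image.
Variables (V W : FImod) (f : fam V W).
Hypotheses (fB : additive_fam f) (fN : natural_fam f).

Lemma im_subgroup : subgroup_fam (im_fam f).
Proof.
split=> [m|m x y [a <-] [b <-]]; first by exists 0; exact: additive0.
by exists (a - b).
Qed.

Lemma im_stable : stable_fam (im_fam f).
Proof. by move=> m p g x gi [a <-]; exists (mor V g a); exact: fN. Qed.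

Lemma chain_in_im n p (y : chain n p W) : chain_in (im_fam f) y <-> exists x, y = chmap f x.
Proof.
split=> [Iy|[x ->]]; last by apply: chain_in_map (chain_in_all x) => m z _; exists z.
have [] := @chain_in_lift n p V W f (@full_sub V) (@zero_sub W) (im_fam f) y _ Iy.
  by move=> m z [x <-]; exists x => //; exact: subrr.
by move=> x _ /chain_in_zero/subr0_eq; exists x.
Qed.

Lemma chain_in_ker n p (x : chain n p V) : chain_in (ker_fam f) x <-> chmap f x = 0.
Proof.
split=> [Kx|x0]; first by apply/chain_in_zero; exact: chain_in_map Kx.
by apply: (chain_in_preim (Q := @zero_sub W)); rewrite x0; exact/chain_in_zero.
Qed.

Lemma Hzero_im_ker p n : Hzero (im_fam f) (@zero_sub W) p n ->
  Hzero (@full_sub V) (ker_fam f) p n.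
Proof.
move=> H u _ cu.
have cfu : cyc (@zero_sub W) (chmap f u).
  by case: p u cu {H} => [|p] u //= /chain_in_ker cu; apply/chain_in_zero; rewrite bd_chmap.
have Iu : chain_in (im_fam f) (chmap f u) by apply/chain_in_im; exists u.
have [v /chain_in_im[y ->] /chain_in_zero e] := H _ Iu cfu.
by exists y; [exact: chain_in_all | apply/chain_in_ker; rewrite chmapB // -bd_chmap].
Qed.

End Image.

(** * Boundaries of 1-chains are the elements of V_{<n} *)

Section Lower.
Variables (k : comPzRingType) (G : group) (V : FIGmod k G).

Lemma bd_lower n (y : chain n 1 (res V)) : lower V n (bd y).
Proof.
have lD (x z : obj V n) : lower V n x -> lower V n z -> lower V n (x + z).
  elim=> [|m f g t u mn f_inj _ IH] lz; rewrite ?add0r // -addrA.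
  by constructor => //; exact: IH.
apply: (@bd_mem n (res V) (@full_sub _)) (chain_in_all y) => //; first exact: lower0.
move=> m f x mn f_inj _; rewrite -[mor _ _ _]addr0; apply: lowerS.
- by rewrite -mn.
- by apply/injectiveP => i j; rewrite !ffunE => /f_inj.
- exact: lower0.
Qed.

(** If f hits the last point, a transposition of the source gives it the form [up g], and induction
    applies to SW; otherwise f factors through the inclusion and the image is a value of [io]. *)
Lemma image_bd n (W : FImod) m (f : 'I_m -> 'I_n) (z : W m) : (m < n)%N ->
  injective f -> exists y : chain n 1 W, bd y = mor W f z.
Proof.
elim: n W m f z => [|n IH] W m f z // mn fi.
have [[j fj]|Nf] := pselect (exists j, f j = ord_max).
  case: m => [|m] in f z mn fi j fj *; first by case: j {fj}.
  pose s : 'I_m.+1 -> 'I_m.+1 := tperm j ord_max.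
  have s_inj : injective s by exact: perm_inj.
  have ss : s \o s =1 id by move=> i; exact: tpermK.
  have /fin_all_exists[g gE] i : exists l, f (s (lift ord_max i)) = lift ord_max l.
    case: (unliftP ord_max (f (s (lift ord_max i)))) => [l ->|]; first by exists l.
    rewrite -fj => /fi /(congr1 s); rewrite [LHS]ss /s tpermL => /eqP.
    by rewrite eq_sym (negbTE (neq_lift _ _)).
  have gi : injective g.
    by move=> i i' /(congr1 (lift ord_max)); rewrite -!gE => /fi/s_inj/lift_inj.
  have [y yE] := IH (shift W) m g (mor W s z) mn gi.
  exists (y, 0); rewrite bdS0 /= (additive0 (@io_add W n)) addr0 yE /=.
  rewrite -mor_comp //; last exact: up_inj.
  apply: mor_ext => i /=; rewrite -[in RHS](ss i) /=.
  by case: (unliftP ord_max (s i)) => [i' ->|->];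
    rewrite ?up_lift ?up_max ?gE // /s tpermR fj.
have /fin_all_exists[g gE] i : exists l, f i = lift ord_max l.
  case: (unliftP ord_max (f i)) => [l ->|fm]; first by exists l.
  by case: Nf; exists i.
have gi : injective g.
  by move=> i i' /(congr1 (lift ord_max)); rewrite -!gE => /fi.
exists (0, mor W g z); rewrite bdS0 /= bd_0 add0r /io -mor_comp //.
  by apply: mor_ext => i /=; rewrite gE.
exact: lift_inj.
Qed.

(** Labels are absorbed by the source, since (f, g) = (f, 1)(id, g). *)
Lemma lower_bd n (x : obj V n) : lower V n x -> exists y : chain n 1 (res V), bd y = x.
Proof.
elim=> [|m f g z t mn f_inj _ [y <-]]; first by exists 0; exact: bd_0.
have [u uE] := @image_bd n (res V) m f (act V (tid m) g z) mn (injectiveP _ f_inj).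
exists (u + y); rewrite bdD uE; congr (_ + _).
rewrite /= (_ : [ffun i => f i] = f); last by apply/ffunP => i; rewrite ffunE.
apply: act_compE => //; first exact: tid_inj.
  by move=> i; rewrite ffunE.
by move=> i; rewrite ffunE gmul1_r.
Qed.

End Lower.

(* The quotient of [rmod j] by the image of [rdif j] is the j-th syzygy of V. *)
Section Resolution.
Variables (k : comPzRingType) (G : group) (V : FIGmod k G) (R : proj_res V).

Definition rmod j : FImod := res (P R j).
Definition rdif j : fam (rmod j.+1) (rmod j) := res_hom (dif R j).
Arguments rdif j : clear implicits.

Lemma rdif_add j : additive_fam (rdif j).
Proof. exact: res_hom_add. Qed.

Lemma rdif_nat j : natural_fam (rdif j).
Proof. exact: res_hom_nat. Qed.

Lemma rmod_acyclic j p n : Hzero (@full_sub (rmod j)) (@zero_sub _) p.+1 n.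
Proof. exact/projective_acyclic/P_proj. Qed.

Lemma rdif_exact j : ker_fam (rdif j) = im_fam (rdif j.+1).
Proof.
apply: functional_extensionality_dep => m; apply/funext => x.
exact/propext/exactS.
Qed.

(** The image of d_j is P_(j+1) modulo ker d_j = im d_(j+1), and P_j is acyclic. *)
Lemma syzygy_shift j p n : Hzero (@full_sub (rmod j)) (im_fam (rdif j)) p.+2 n ->
  Hzero (@full_sub (rmod j.+1)) (im_fam (rdif j.+1)) p.+1 n.
Proof.
move=> H; rewrite -rdif_exact; apply: Hzero_im_ker; [exact: rdif_add|exact: rdif_nat|].
by apply: Hzero_shift H => q; exact: rmod_acyclic.
Qed.

Lemma syzygy_iter j p n : Hzero (@full_sub (rmod j)) (im_fam (rdif j)) p.+1 n ->
  Hzero (@full_sub (rmod (p + j))) (im_fam (rdif (p + j))) 1 n.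
Proof.
elim: p j => [|p IH] j // /syzygy_shift/IH; by rewrite addnS.
Qed.

(** If d x is a boundary, it is one of a chain d v; then x - bd v is in ker d, hence comes from
    P_(j+2), while bd v is in the lower part. *)
Lemma Hzero_Hvan j n : Hzero (@full_sub (rmod j)) (im_fam (rdif j)) 1 n ->
  Hvan V R j.+1 n.
Proof.
move=> H x /lower_bd[w wx].
have Iw : chain_in (p := 0) (im_fam (rdif j)) (bd w) by exists x.
have [y /chain_in_im[v ->]] := Hzero_quot_inv H Iw.
rewrite wx bd_chmap; [|exact: rdif_add|exact: rdif_nat] => xv.
have /exactS[u uE] : dif R j n (x - bd v) = 0.
  by rewrite (linear_B (hom_lin (dif R j) n)) xv; exact: subrr.
exists u; rewrite uE opprB addrC subrK; exact: bd_lower.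
Qed.

Lemma Hvan_Hzero n : Hvan V R 1 n -> Hzero (@full_sub (rmod 0)) (im_fam (rdif 0)) 1 n.
Proof.
move=> H; apply: Hzero_quot => [p|w [x xw]]; first exact: rmod_acyclic.
have [|u /lower_bd[v vE]] := H x.
  by change (lower (P R 0) n (rdif 0 n x)); rewrite xw; exact: bd_lower.
exists (chmap (rdif 0) v); first by apply/chain_in_im; exists v.
rewrite bd_chmap; [|exact: rdif_add|exact: rdif_nat].
rewrite vE -xw; apply/esym; apply: (eq_trans (rdif_add _ _)).
rewrite (_ : rdif 0 n (dif R 1 n u) = 0) ?subr0 //.
by apply/exactS; exists u.
Qed.

(** The chain bounding eps x lifts to P_0 coordinate by coordinate, as eps is onto. *)
Lemma gen_Hzero d n : gen_in_deg V d -> (d < n)%N ->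
  Hzero (@full_sub (rmod 0)) (im_fam (rdif 0)) 0 n.
Proof.
move=> Vd dn x _ _; have [v vx] := lower_bd (Vd n dn (eps R n x)).
pose e := res_hom (eps R).
have [w _ /chain_in_zero/subr0_eq vw] : exists2 w, chain_in (@full_sub _) w &
    chain_in (@zero_sub _) (v - chmap e w).
  apply: chain_in_lift (chain_in_all v) => m y _.
  by have [z zy] := eps_surj _ _ _ R m y; exists z => //; rewrite /zero_sub -zy subrr.
exists w; first exact: chain_in_all.
have /exact0[u uE] : eps R n (x - bd w) = 0.
  rewrite (linear_B (hom_lin (eps R) n)) -vx vw bd_chmap ?subrr //.
    exact: res_hom_add.
  exact: res_hom_nat.
by exists u.
Qed.

End Resolution.

Theorem theoremA (k : comPzRingType) (G : group) (V : FIGmod k G) (d r : nat) :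
  gen_in_deg V d -> hd_le V 1 r ->
  forall i : nat, (1 <= i)%N -> hd_le V i (i + r + minn r d - 1).
Proof.
move=> Vd Vr [|p] // _ R n pn.
(* P_0 / im d_0 is V; p dimension shifts turn its H_(p+1) into H_1 of a syzygy. *)
suff H : Hzero (@full_sub (rmod R 0)) (im_fam (@rdif _ _ _ R 0)) p.+1 n.
  by have := syzygy_iter H; rewrite addn0; exact: Hzero_Hvan.
(* H_0(V) vanishes from degree d + 1 on, so e = d + 1 and min(r + 1, e) = min(r, d) + 1. *)
apply: (@Hzero_regularity d.+1 r); last by lia.
- exact/im_subgroup/rdif_add.
- exact/im_stable/rdif_nat.
- by move=> m; exact: gen_Hzero.
- by move=> m rm; apply: Hvan_Hzero; exact: Vr.
Qed.
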